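(* Let $K$ be a field, let $I\subset S=K[x_1,\ldots,x_n]$ be a monomial ideal and let $u\in S$ be a monomial. Then: (1) $\operatorname{sdepth}_S(I:u)\ge\operatorname{sdepth}_S(I)$. (2) $\operatorname{sdepth}_S(S/(I:u))\ge\operatorname{sdepth}_S(S/I)$.
   Context: Let $S=K[x_1,\ldots,x_n]$ with its $\mathbb Z^n$-grading, and let $M\neq 0$ be a finitely generated $\mathbb Z^n$-graded $S$-module. A Stanley decomposition of $M$ is a finite direct sum decomposition of $K$-vector spaces $\mathcal D: M=\bigoplus_{i=1}^t m_iK[Z_i]$, where the $m_i\in M$ are homogeneous, $Z_i\subset\{x_1,\ldots,x_n\}$, and each $m_iK[Z_i]$ is a free $K[Z_i]$-module. Put $\operatorname{sdepth}(\mathcal D)=\min_i|Z_i|$, and let $\operatorname{sdepth}_S(M)$ be the maximum of $\operatorname{sdepth}(\mathcal D)$ over all Stanley decompositions of $M$. Stanley depth is considered only for nonzero modules: each inequality is asserted whenever all modules occurring in it are nonzero (so $I\ne 0$ in (1), and $u\notin I$ in (2)). Here $(I:u)=\{f\in S: fu\in I\}$. *)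

(* Defs.v *)
From HB Require Import structures.
From mathcomp Require Import all_boot all_order all_algebra.
From mathcomp Require Import boolp.
From mathcomp Require Import mpoly.

Set Implicit Arguments.
Unset Strict Implicit.
Unset Printing Implicit Defensive.

Import GRing.Theory.
Local Open Scope ring_scope.

Section SubQuotientModules.

Variables (R : nzRingType) (V : lmodType R) (N : submodClosed V).

Record submod := Submod { submod_val : V; _ : submod_val \in N }.

HB.instance Definition _ := [isSub for submod_val].
HB.instance Definition _ := [Choice of submod by <:].
HB.instance Definition _ := [SubChoice_isSubLmodule of submod by <:].

Definition submod_zmodClosed : zmodClosed V :=
  HB.pack (GRing.SubmodClosed.sort N) (GRing.isZmodClosed.Build V
    (GRing.SubmodClosed.sort N)
    (GRing.submod_closedB (submodClosedP N))).

Definition quotmod : Type := Quotient.quot submod_zmodClosed.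

HB.instance Definition _ := GRing.Zmodule.on quotmod.

Definition quotmod_pi (x : V) : quotmod := (\pi_(Quotient.quot submod_zmodClosed) x)%qT.

Definition quotmod_scale (a : R) (x : quotmod) : quotmod :=
  quotmod_pi (a *: (repr x : V)).

Lemma quotmod_pi_eq x y : (quotmod_pi x == quotmod_pi y) = (x - y \in N).
Proof. exact/esym/(Quotient.idealrBE submod_zmodClosed). Qed.

Lemma quotmod_piD x y : quotmod_pi (x + y) = quotmod_pi x + quotmod_pi y.
Proof. exact: Quotient.pi_add. Qed.

Lemma quotmod_piB x y : quotmod_pi (x - y) = quotmod_pi x - quotmod_pi y.
Proof. by rewrite quotmod_piD; congr (_ + _); exact: Quotient.pi_opp. Qed.

Lemma quotmod_piP (x : quotmod) : exists f, x = quotmod_pi f.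
Proof. by exists (repr x); rewrite /quotmod_pi reprK. Qed.

Lemma quotmod_pi0 : quotmod_pi 0 = 0.
Proof. by rewrite -(subrr 0) quotmod_piB subrr. Qed.

Lemma quotmod_pi_eq0 x : (quotmod_pi x == 0) = (x \in N).
Proof. by rewrite -quotmod_pi0 quotmod_pi_eq subr0. Qed.

Lemma quotmod_pi_sum (T : Type) (s : seq T) (P : pred T) (F : T -> V) :
  quotmod_pi (\sum_(i <- s | P i) F i) = \sum_(i <- s | P i) quotmod_pi (F i).
Proof. exact: (big_morph _ quotmod_piD quotmod_pi0). Qed.

Lemma quotmod_scale_pi a x :
  quotmod_scale a (quotmod_pi x) = quotmod_pi (a *: x).
Proof.
apply/eqP; rewrite quotmod_pi_eq -scalerBr rpredZ // -quotmod_pi_eq.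
by rewrite /quotmod_pi reprK.
Qed.

Fact quotmod_scaleA a b x :
  quotmod_scale a (quotmod_scale b x) = quotmod_scale (a * b) x.
Proof. by have [f ->] := quotmod_piP x; rewrite !quotmod_scale_pi scalerA. Qed.

Fact quotmod_scale1 : left_id 1 quotmod_scale.
Proof. by move=> x; have [f ->] := quotmod_piP x; rewrite quotmod_scale_pi scale1r. Qed.

Fact quotmod_scaleDr : right_distributive quotmod_scale +%R.
Proof.
move=> a x y; have [f ->] := quotmod_piP x; have [g ->] := quotmod_piP y.
by rewrite -quotmod_piD !quotmod_scale_pi -quotmod_piD scalerDr.
Qed.

Fact quotmod_scaleDl x : {morph quotmod_scale^~ x : a b / a + b}.
Proof.
by move=> a b; have [f ->] := quotmod_piP x;
  rewrite !quotmod_scale_pi -quotmod_piD scalerDl.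
Qed.

HB.instance Definition _ := GRing.Zmodule_isLmodule.Build R quotmod
  quotmod_scaleA quotmod_scale1 quotmod_scaleDr quotmod_scaleDl.

Lemma quotmod_piZ a x : quotmod_pi (a *: x) = a *: quotmod_pi x.
Proof. by rewrite -quotmod_scale_pi. Qed.

End SubQuotientModules.

Section Graded.

Variables (K : fieldType) (n : nat).
Local Notation S := {mpoly K[n]}.

Definition zdeg (m : 'X_{1..n}) : 'rV[int]_n := \row_i (m i)%:Z.

Record gradedModule := GradedModule {
  gm_sort :> lmodType S;
  gm_piece : 'rV[int]_n -> gm_sort -> Prop;
  gm_piece0 : forall a, gm_piece a 0;
  gm_pieceB : forall a x y, gm_piece a x -> gm_piece a y -> gm_piece a (x - y);
  gm_pieceZ : forall (c : K) (m : 'X_{1..n}) a x,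
    gm_piece a x -> gm_piece (zdeg m + a) ((c *: 'X_[m] : S) *: x);
  gm_piece_span : forall x : gm_sort,
    exists (s : seq 'rV[int]_n) (y : 'rV[int]_n -> gm_sort),
      [/\ uniq s, forall a, gm_piece a (y a) & x = \sum_(a <- s) y a];
  gm_piece_indep : forall (s : seq 'rV[int]_n) (y : 'rV[int]_n -> gm_sort),
    uniq s -> (forall a, gm_piece a (y a)) -> \sum_(a <- s) y a = 0 ->
    forall a, a \in s -> y a = 0
}.

Definition homogeneous (M : gradedModule) (x : M) : Prop :=
  exists a, gm_piece a x.

(* The subring K[Z] of S, where i : 'I_n stands for the variable 'X_i. *)
Definition poly_in (Z : {set 'I_n}) (p : S) : Prop :=
  forall m, m \in msupp p -> forall i, i \notin Z -> m i = 0%N.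

Definition stanley_space (M : gradedModule) (x : M) (Z : {set 'I_n}) (y : M)
  : Prop := exists2 p : S, poly_in Z p & y = p *: x.

(* stanley_space x Z is x K[Z].  In sd_free, the generator of each
   summand is a basis of it over K[Z_i].  Since the summand is cyclic and K[Z_i]
   is a domain, this excludes exactly the non-free and the zero summands. *)
Record stanleyDecomp (M : gradedModule) := StanleyDecomp {
  sd_size : nat;
  sd_gen : 'I_sd_size -> M;
  sd_vars : 'I_sd_size -> {set 'I_n};
  sd_homog : forall i, homogeneous (sd_gen i);
  sd_free : forall i (p : S),
    poly_in (sd_vars i) p -> p *: sd_gen i = 0 -> p = 0;
  sd_span : forall x : M, exists2 y : 'I_sd_size -> M,
    forall i, stanley_space (sd_gen i) (sd_vars i) (y i) & x = \sum_i y i;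
  sd_direct : forall y : 'I_sd_size -> M,
    (forall i, stanley_space (sd_gen i) (sd_vars i) (y i)) ->
    \sum_i y i = 0 -> forall i, y i = 0
}.

(* The minimum of the #|Z_i|; these are at most n, so the default value n is
   only relevant to the empty decomposition, i.e., to M = 0. *)
Definition sdepth_decomp (M : gradedModule) (D : stanleyDecomp M) : nat :=
  \big[minn/n]_(i < sd_size D) #|sd_vars i|.

(* The values of sdepth_decomp lie in 0, ..., n, so this is its maximum over all
   D (and 0 if there is no D). *)
Definition sdepth (M : gradedModule) : nat :=
  \max_(d < n.+1 | `[< exists D : stanleyDecomp M, sdepth_decomp D = d >]) d.

Definition monomially_generated (I : {pred S}) : Prop :=
  exists G : 'X_{1..n} -> Prop, forall f, f \in I <->
    exists2 s : seq (S * 'X_{1..n}),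
      forall p, p \in s -> G p.2 & f = \sum_(p <- s) p.1 * 'X_[p.2].

Record monomialIdeal := MonomialIdeal {
  mideal :> {pred S};
  midealP : monomially_generated mideal
}.

Implicit Types (I : monomialIdeal) (f g : S).

Fact mideal_submod_closed I : submod_closed (mideal I : {pred S^o}).
Proof.
have [G genI] := midealP I; split=> [|a f g /genI[s sG ->] /genI[t tG ->]].
  by apply/genI; exists [::] => //; rewrite big_nil.
apply/genI; exists ([seq (a * p.1, p.2) | p <- s] ++ t) => [p|].
  by rewrite mem_cat => /orP[/mapP[q qs ->]|]; [exact: (sG q)|exact: tG].
rewrite big_cat big_map /=; congr (_ + _).
rewrite /GRing.scale /= mulr_sumr; apply: eq_bigr => p _.
by rewrite mulrA.
Qed.

Definition mideal_submod I : submodClosed S^o :=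
  HB.pack (mideal I) (GRing.isSubmodClosed.Build S S^o (mideal I)
    (GRing.submod_closed_semi (mideal_submod_closed I))).

Lemma midealMl I f g : g \in I -> f * g \in I.
Proof.
move=> gI; have [I0 Il] := mideal_submod_closed I.
by rewrite -[f * g]addr0; exact: Il f g 0 gI I0.
Qed.

Lemma midealZ I (c : K) g : g \in I -> c *: g \in I.
Proof. by rewrite -mul_mpolyC; apply: midealMl. Qed.

Lemma mideal_sum I (T : eqType) (s : seq T) (P : pred T) (F : T -> S) :
  (forall i, i \in s -> P i -> F i \in I) -> \sum_(i <- s | P i) F i \in I.
Proof.
move=> FI; rewrite big_seq_cond.
by apply: (@rpred_sum S^o (mideal_submod I)) => i /andP[]; exact: FI.
Qed.

Lemma mideal_msupp I f m : f \in I -> m \in msupp f -> 'X_[m] \in I.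
Proof.
have [G genI] := midealP I; move=> /genI[s sG ->].
move/msupp_sum_le/flattenP => [ms /mapP[p]]; rewrite mem_filter /= => ps ->.
move/msuppM_le/allpairsP => [[m1 m2] /= [m1p m2p ->]].
move: m2p; rewrite msuppX inE => /eqP ->; rewrite mpolyXD; apply: midealMl.
by apply/genI; exists [:: (1, p.2)] => [q|];
  rewrite ?inE ?big_seq1 ?mul1r // => /eqP ->; exact: (sG p).
Qed.

Lemma msupp_mideal I f : (forall m, m \in msupp f -> 'X_[m] \in I) -> f \in I.
Proof.
by move=> fI; rewrite [f]mpolyE; apply: mideal_sum => m /fI mI _; exact: midealZ.
Qed.

Definition colon_pred I g : {pred S} := [pred f | f * g \in I].

Fact colon_monomially_generated I (u : 'X_{1..n}) :
  monomially_generated (colon_pred I 'X_[u]).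
Proof.
exists (fun m => 'X_[m] \in colon_pred I 'X_[u]) => f; split=> [fI|[s sI ->]].
  exists [seq ((f@_m)%:MP, m) | m <- msupp f] => [_ /mapP[m mf ->]/=|].
    rewrite inE -mpolyXD; apply: (mideal_msupp (fI : f * 'X_[u] \in I)).
    by rewrite mcoeff_msupp addmC mcoeffMX -mcoeff_msupp.
  by rewrite big_map {1}[f]mpolyE; apply: eq_bigr => m _; rewrite mul_mpolyC.
rewrite inE mulr_suml; apply: mideal_sum => p /sI pI _.
by rewrite -mulrA; exact: midealMl.
Qed.

Definition colon I (u : 'X_{1..n}) : monomialIdeal :=
  MonomialIdeal (colon_monomially_generated I u).

Definition mpoly_piece (a : 'rV[int]_n) (f : S) : Prop :=
  forall m, m \in msupp f -> zdeg m = a.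

Definition mpoly_proj (a : 'rV[int]_n) (f : S) : S :=
  \sum_(m <- msupp f | zdeg m == a) f@_m *: 'X_[m].

Lemma mpoly_projE a f m : (mpoly_proj a f)@_m = if zdeg m == a then f@_m else 0.
Proof.
rewrite /mpoly_proj raddf_sum /= (eq_bigr (fun k => if k == m then f@_m else 0)).
  rewrite -big_mkcondr /=; have [mf|mf] := boolP (m \in msupp f).
    case: ifP => ma; last first.
      by rewrite big1 // => k /andP[ka /eqP km]; rewrite -km ka in ma.
    rewrite (big_rem m) //= ma eqxx big_seq_cond big1 ?addr0 // => k.
    by rewrite mem_rem_uniq ?msupp_uniq // inE => /andP[/andP[/negPf->]]; rewrite andbF.
  have f0 : f@_m = 0 by apply/eqP; move: mf; rewrite mcoeff_msupp negbK.
  by rewrite f0 big1 // if_same.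
by move=> k _; rewrite mcoeffZ mcoeffX; case: eqP => [->|_]; rewrite ?mulr1 ?mulr0.
Qed.

Lemma mpoly_pieceP a f :
  mpoly_piece a f <-> forall b, mpoly_proj b f = if a == b then f else 0.
Proof.
split=> [fa b|fa m].
  apply/mpolyP => m; rewrite mpoly_projE.
  have [/fa->|] := boolP (m \in msupp f); first by case: ifP; rewrite ?mcoeff0.
  by rewrite mcoeff_msupp negbK => /eqP f0; do 2![case: ifP => _]; rewrite ?mcoeff0.
rewrite mcoeff_msupp => fm; apply/eqP; apply: contraNT fm => ma.
have := congr1 (mcoeff m) (fa a); rewrite eqxx mpoly_projE (negPf ma).
by move=> <-.
Qed.

Lemma mpoly_proj_piece a f : mpoly_piece a (mpoly_proj a f).
Proof.
move=> m; rewrite mcoeff_msupp mpoly_projE.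
by case: (zdeg m =P a) => // _; rewrite eqxx.
Qed.

Lemma mpoly_proj_is_zmod_morphism a : zmod_morphism (mpoly_proj a).
Proof.
move=> f g; apply/mpolyP => m; rewrite mcoeffB !mpoly_projE mcoeffB.
by case: ifP; rewrite ?subr0.
Qed.

HB.instance Definition _ a := GRing.isZmodMorphism.Build S S (mpoly_proj a)
  (mpoly_proj_is_zmod_morphism a).

Lemma mpoly_proj_mideal I a f : f \in I -> mpoly_proj a f \in I.
Proof.
by move=> fI; apply: mideal_sum => m mf _; apply/midealZ/(mideal_msupp fI).
Qed.

Lemma mpoly_sum_proj f :
  f = \sum_(a <- undup [seq zdeg m | m <- msupp f]) mpoly_proj a f.
Proof.
apply/mpolyP => m; rewrite raddf_sum /=.
under eq_bigr do rewrite mpoly_projE eq_sym.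
have [mf|] := boolP (m \in msupp f); last first.
  by rewrite mcoeff_msupp negbK => /eqP->; rewrite big1 // => a _; rewrite if_same.
rewrite -big_mkcond (big_rem (zdeg m)) /=; last by rewrite mem_undup map_f.
rewrite eqxx big_seq_cond big1 ?addr0 // => a.
by rewrite mem_rem_uniq ?undup_uniq // inE => /andP[/andP[/negPf->]].
Qed.

Lemma mpoly_piece0 a : mpoly_piece a 0.
Proof. by move=> m; rewrite msupp0. Qed.

Lemma mpoly_pieceB a f g :
  mpoly_piece a f -> mpoly_piece a g -> mpoly_piece a (f - g).
Proof.
move=> fa ga m /msuppB_le; rewrite mem_cat => /orP[/fa|/ga] //.
Qed.

Lemma mpoly_pieceZ (c : K) m a f :
  mpoly_piece a f -> mpoly_piece (zdeg m + a) (c *: 'X_[m] * f).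
Proof.
move=> fa k /msuppM_le/allpairsP[[k1 k2] /= [/msuppZ_le k1m /fa <- ->]].
move: k1m; rewrite msuppX inE => /eqP->.
by apply/rowP => i; rewrite !mxE mnmDE PoszD.
Qed.

Lemma mpoly_proj_sum (s : seq 'rV[int]_n) (y : 'rV[int]_n -> S) b :
  uniq s -> (forall a, mpoly_piece a (y a)) -> b \in s ->
  mpoly_proj b (\sum_(a <- s) y a) = y b.
Proof.
move=> us ya bs; rewrite raddf_sum (big_rem b) //= big_seq_cond big1 ?addr0.
  by have /mpoly_pieceP/(_ b) := ya b; rewrite eqxx.
move=> a; rewrite mem_rem_uniq // inE => /andP[/andP[/negPf ab _] _].
by have /mpoly_pieceP/(_ b) := ya a; rewrite ab.
Qed.

Section IdealModule.

Variable I : monomialIdeal.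
Local Notation M := (submod (mideal_submod I)).

Definition ideal_elt (f : S) (fI : f \in mideal I) : M :=
  @Submod S S^o (mideal_submod I) f fI.

Definition ideal_piece a (x : M) : Prop := mpoly_piece a (val x).

Fact ideal_piece0 a : ideal_piece a 0.
Proof. exact: mpoly_piece0. Qed.

Fact ideal_pieceB a x y :
  ideal_piece a x -> ideal_piece a y -> ideal_piece a (x - y).
Proof. exact: mpoly_pieceB. Qed.

Fact ideal_pieceZ (c : K) (m : 'X_{1..n}) a x :
  ideal_piece a x -> ideal_piece (zdeg m + a) ((c *: 'X_[m] : S) *: x).
Proof. exact: mpoly_pieceZ. Qed.

Fact ideal_piece_span (x : M) :
  exists (s : seq 'rV[int]_n) (y : 'rV[int]_n -> M),
    [/\ uniq s, forall a, ideal_piece a (y a) & x = \sum_(a <- s) y a].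
Proof.
exists (undup [seq zdeg m | m <- msupp (val x : S)]).
exists (fun a => ideal_elt (mpoly_proj_mideal a (valP x))).
split=> [|a|]; [exact: undup_uniq | exact: mpoly_proj_piece |].
by apply: val_inj; rewrite raddf_sum /=; exact: mpoly_sum_proj.
Qed.

Fact ideal_piece_indep (s : seq 'rV[int]_n) (y : 'rV[int]_n -> M) :
  uniq s -> (forall a, ideal_piece a (y a)) -> \sum_(a <- s) y a = 0 ->
  forall a, a \in s -> y a = 0.
Proof.
move=> us ya y0 b bs; apply: val_inj.
rewrite -[LHS](mpoly_proj_sum (y := fun a => val (y a)) us ya bs).
by move/(congr1 val): y0; rewrite raddf_sum /= => ->; rewrite raddf0.
Qed.

Definition ideal_module : gradedModule :=
  GradedModule ideal_piece0 ideal_pieceB ideal_pieceZ ideal_piece_span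
    ideal_piece_indep.

End IdealModule.

Section QuotientModule.

Variable I : monomialIdeal.
Local Notation N := (mideal_submod I).
Local Notation M := (quotmod N).

Definition quotient_piece a (x : M) : Prop :=
  exists2 f : S, mpoly_piece a f & x = quotmod_pi N f.

Fact quotient_piece0 a : quotient_piece a 0.
Proof. by exists 0; [exact: mpoly_piece0 | rewrite quotmod_pi0]. Qed.

Fact quotient_pieceB a x y :
  quotient_piece a x -> quotient_piece a y -> quotient_piece a (x - y).
Proof.
move=> [f fa ->] [g ga ->]; exists (f - g); first exact: mpoly_pieceB.
by rewrite -quotmod_piB.
Qed.

Fact quotient_pieceZ (c : K) (m : 'X_{1..n}) a x :
  quotient_piece a x -> quotient_piece (zdeg m + a) ((c *: 'X_[m] : S) *: x).
Proof.
move=> [f fa ->]; exists (c *: 'X_[m] * f); first exact: mpoly_pieceZ.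
by rewrite -quotmod_piZ.
Qed.

Fact quotient_piece_span (x : M) :
  exists (s : seq 'rV[int]_n) (y : 'rV[int]_n -> M),
    [/\ uniq s, forall a, quotient_piece a (y a) & x = \sum_(a <- s) y a].
Proof.
have [f ->] := quotmod_piP x.
exists (undup [seq zdeg m | m <- msupp (f : S)]).
exists (fun a => quotmod_pi N (mpoly_proj a f)).
split=> [|a|]; first exact: undup_uniq.
  by exists (mpoly_proj a f) => //; exact: mpoly_proj_piece.
by rewrite -quotmod_pi_sum; congr quotmod_pi; exact: mpoly_sum_proj.
Qed.

Fact quotient_piece_indep (s : seq 'rV[int]_n) (y : 'rV[int]_n -> M) :
  uniq s -> (forall a, quotient_piece a (y a)) -> \sum_(a <- s) y a = 0 ->
  forall a, a \in s -> y a = 0.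
Proof.
move=> us ya y0 b bs.
have /choice[f fP] : forall a, exists f : S,
    mpoly_piece a f /\ y a = quotmod_pi N f.
  by move=> a; have [f ? ?] := ya a; exists f.
have fI : \sum_(a <- s) f a \in mideal I.
  rewrite -[_ \in _](quotmod_pi_eq0 N) quotmod_pi_sum; apply/eqP.
  by rewrite -[RHS]y0; apply: eq_bigr => a _; rewrite (fP a).2.
apply/eqP; rewrite (fP b).2 quotmod_pi_eq0.
rewrite -(mpoly_proj_sum us (fun a => (fP a).1) bs).
exact: mpoly_proj_mideal.
Qed.

Definition quotient_module : gradedModule :=
  GradedModule quotient_piece0 quotient_pieceB quotient_pieceZ
    quotient_piece_span quotient_piece_indep.

End QuotientModule.

End Graded.

(* Main.v *)
Require Import Defs.
From HB Require Import structures.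
From mathcomp Require Import all_boot all_order all_algebra.
From mathcomp Require Import boolp.
From mathcomp Require Import mpoly.
From mathcomp Require Import zify.

Set Implicit Arguments.
Unset Strict Implicit.
Unset Printing Implicit Defensive.

Import GRing.Theory.
Local Open Scope ring_scope.

(** A Stanley decomposition of I or of S/I is, up to scaling the
generators, the same thing as a finite partition of the set P of monomials in I, respectively outside I, into boxes
x^a * {monomials in the variables of Z}: homogeneous elements of these modules
are scalar multiples of monomials, and freeness of a summand says that its box
stays inside P.  So sdepth >= d means that P can be partitioned into boxes
whose sets Z have at least d elements ([stanley_box_partition],
[box_partition_stanley]).

For both modules, replacing I by (I : u) replaces P by the set of all m with
m + u in P.  The preimage of a box (a, Z) under m |-> m + u is either empty, when
some coordinate outside Z has a_j < u_j, or again a box with the same Z and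
with corner max(a, u) - u ([box_shift]).  Hence a partition of P into boxes
pulls back to one in which only directions Z of the old partition occur
([box_partition_shift]), which cannot lower the minimum of the #|Z|.

Both modules are treated at once by means of a K-linear isomorphism onto the
span of the monomials in P, on which S acts by multiplication followed by
truncation to P ([monomial_chart]). *)

(** * Partitions of a set of monomials into boxes *)

Section Boxes.
Variable n : nat.
Implicit Types (a m u : 'X_{1..n}) (Z : {set 'I_n}) (P : pred 'X_{1..n}).

Definition box a Z : pred 'X_{1..n} :=
  fun m => [forall i, if i \in Z then (a i <= m i)%N else m i == a i].

Lemma box_lem a Z m : box a Z m -> (a <= m)%MM.
Proof.
by move=> /forallP am; apply/mnm_lepP => i; have := am i; case: ifP => // _ /eqP->.
Qed.

Lemma box_addm a Z (k : 'X_{1..n}) :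
  (forall i, i \notin Z -> k i = 0%N) -> box a Z (k + a)%MM.
Proof.
move=> kZ; apply/forallP => i; rewrite mnmDE; case: ifPn => [_|/kZ->].
  exact: leq_addl.
by rewrite add0n.
Qed.

(** The corner is written [a - u] because subtraction of exponents is truncated,
so that it equals max(a, u) - u. *)
Lemma box_shift a Z m u :
  box a Z (m + u)%MM =
    [forall i, (i \notin Z) ==> (u i <= a i)%N] && box (a - u)%MM Z m.
Proof.
apply/forallP/andP => [amu|[/forallP ua /forallP am] i].
  split; apply/forallP => i; have := amu i; rewrite ?mnmBE mnmDE.
    by case: (i \in Z) => //= /eqP <-; apply: leq_addl.
  by case: (i \in Z) => /=; lia.
have := am i; have := ua i; rewrite mnmBE mnmDE.
by case: (i \in Z) => /=; lia.
Qed.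

(** Several values of the index may not share a box, as boxes are nonempty;
so the cover and uniqueness conditions describe a partition. *)
Definition box_partition P (d : nat) : Prop :=
  exists (t : nat) (a : 'I_t -> 'X_{1..n}) (Z : 'I_t -> {set 'I_n}),
    [/\ forall m, P m <-> exists i, box (a i) (Z i) m,
        forall m i j, box (a i) (Z i) m -> box (a j) (Z j) m -> i = j
      & forall i, (d <= #|Z i|)%N].

(** Pull the boxes back one by one, after discarding those whose preimage under
the shift is empty. *)
Lemma box_partition_shift P d u :
  box_partition P d -> box_partition (fun m => P (m + u)%MM) d.
Proof.
move=> [t [a [Z [cov disj dZ]]]].
pose A := [set i : 'I_t | [forall j, (j \notin Z i) ==> (u j <= a i j)%N]].
exists #|A|, (fun k => (a (enum_val k) - u)%MM), (fun k => Z (enum_val k)).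
have boxA (k : 'I_#|A|) m : box (a (enum_val k) - u)%MM (Z (enum_val k)) m ->
    box (a (enum_val k)) (Z (enum_val k)) (m + u)%MM.
  by move=> bm; have := enum_valP k; rewrite inE box_shift => ->.
split=> [m|m i j /boxA bi /boxA bj|k]; last exact: dZ.
  split=> [/cov[i]|[k /boxA bk]]; last by apply/cov; exists (enum_val k).
  rewrite box_shift => /andP[iA bi]; have iA' : i \in A by rewrite inE.
  by exists (enum_rank_in iA' i); rewrite enum_rankK_in.
exact: enum_val_inj (disj _ _ _ bi bj).
Qed.

End Boxes.

(** * Modules with a basis of monomials *)

Section Charts.
Variables (K : fieldType) (n : nat).
Local Notation S := {mpoly K[n]}.
Implicit Types (a m u : 'X_{1..n}) (Z : {set 'I_n}) (P : pred 'X_{1..n}).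

Lemma mcoeffMX_le (p : S) a m :
  (p * 'X_[a])@_m = if (a <= m)%MM then p@_(m - a)%MM else 0.
Proof.
case: ifPn => [am|am]; first by rewrite -{1}(submK am) addmC mcoeffMX.
apply/memN_msupp_eq0; apply: contra am => /msuppM_le/allpairsP[[k l] /= [_ +]].
by rewrite msuppX inE => /eqP-> ->; apply: lem_addl.
Qed.

Lemma poly_in_box Z (p : S) a m :
  poly_in Z p -> (a <= m)%MM -> p@_(m - a)%MM != 0 -> box a Z m.
Proof.
move=> pZ am; rewrite -mcoeff_msupp => /pZ pm.
by rewrite -(submK am); apply: box_addm.
Qed.

Lemma box_poly_in Z a m : box a Z m -> poly_in Z ('X_[(m - a)%MM] : S).
Proof.
move=> /forallP am k; rewrite msuppX inE => /eqP-> i iZ.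
by have := am i; rewrite (negPf iZ) mnmBE => /eqP->; rewrite subnn.
Qed.

(** The summand of [f] supported in a box, divided by the corner of the box: the
coefficient in K[Z] of the corresponding generator when [f] is decomposed. *)
Definition box_part (f : S) a Z : S :=
  \sum_(m <- msupp f | box a Z m) f@_m *: 'X_[(m - a)%MM].

Lemma box_part_poly_in f a Z : poly_in Z (box_part f a Z).
Proof.
move=> k /msupp_sum_le/flattenP[ms /mapP[m]]; rewrite mem_filter => /andP[bm _] ->.
by move=> /msuppZ_le; apply: box_poly_in.
Qed.

Lemma mcoeff_box_part f a Z m : box a Z m -> (box_part f a Z)@_(m - a)%MM = f@_m.
Proof.
move=> bm; rewrite raddf_sum /=.
under eq_bigr => k _ do rewrite mcoeffZ mcoeffX.
have other k : box a Z k -> k != m -> f@_k * ((k - a)%MM == (m - a)%MM)%:R = 0.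
  move=> bk km; case: eqP => [E|_]; last by rewrite mulr0.
  by case/eqP: km; rewrite -(submK (box_lem bk)) E (submK (box_lem bm)).
have [mf|/memN_msupp_eq0 f0] := boolP (m \in msupp f).
  rewrite big_mkcond (bigD1_seq m) //= bm eqxx mulr1 big1 ?addr0 // => k km.
  by case: ifP => // bk; apply: other.
rewrite big1 ?f0 // => k bk; have [->|] := eqVneq k m; last exact: other.
by rewrite f0 mul0r.
Qed.

Lemma zdeg_inj : injective (@zdeg n).
Proof.
by move=> a b /rowP ab; apply/mnmP => i; have := ab i; rewrite !mxE => -[].
Qed.

(** Distinct monomials have distinct Z^n-degrees, so the graded pieces of S have
dimension at most one. *)
Lemma mpoly_piece_term (b : 'rV[int]_n) (f : S) :
  mpoly_piece b f -> f != 0 -> exists c m, c != 0 /\ f = c *: 'X_[m].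
Proof.
move=> fb; rewrite -msupp_eq0; case E : (msupp f) => [//|m s] _.
have mf : m \in msupp f by rewrite E mem_head.
exists f@_m, m; split; first by rewrite -mcoeff_msupp.
apply/mpolyP => k; rewrite mcoeffZ mcoeffX; case: eqP => [<-|mk].
  by rewrite mulr1.
rewrite mulr0; apply/memN_msupp_eq0/negP => /fb kb; apply: mk.
by apply: zdeg_inj; rewrite kb fb.
Qed.

(** Taking p = 1 in [chart_scale] shows that the image of a chart is supported
in P; with [chart_onto] it is the K-span of the monomials in P.  The truncation
to P in [chart_scale] is what allows S/I, where products may vanish. *)
Record monomial_chart (M : gradedModule K n) P := MonomialChart {
  chart :> {additive M -> S};
  chart_inj : injective chart;
  chart_onto : forall m, P m -> exists x, chart x = 'X_[m];
  chart_scale : forall (p : S) (x : M) m,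
    (chart (p *: x))@_m = if P m then (p * chart x)@_m else 0;
  chart_homogeneous : forall x : M,
    homogeneous x <-> exists b, mpoly_piece b (chart x)
}.

Arguments chart_inj {M P} phi [x1 x2] : rename.

Section OneChart.
Variables (M : gradedModule K n) (P : pred 'X_{1..n}) (phi : monomial_chart M P).

Lemma chart_supp (x : M) m : ~~ P m -> (phi x)@_m = 0.
Proof. by move=> Pm; rewrite -[x]scale1r chart_scale (negPf Pm). Qed.

Lemma chart_term_scale (c : K) (a : 'X_{1..n}) (g : M) (p : S) m :
  phi g = c *: 'X_[a] ->
  (phi (p *: g))@_m = if P m && (a <= m)%MM then c * p@_(m - a)%MM else 0.
Proof.
move=> ga; rewrite chart_scale ga -scalerAr mcoeffZ mcoeffMX_le.
by case: (P m); case: (a <= m)%MM; rewrite //= mulr0.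
Qed.

(** The corner of the i-th box is the exponent of the i-th generator, seen in the
chart.  Freeness keeps the box inside P, the spanning property makes the boxes
cover P, and directness makes them disjoint. *)
Lemma stanley_box_partition (D : stanleyDecomp M) :
  box_partition P (sdepth_decomp D).
Proof.
pose g := @sd_gen _ _ _ D; pose Z := @sd_vars _ _ _ D.
have term i : exists ca : K * 'X_{1..n},
    ca.1 != 0 /\ phi (g i) = ca.1 *: 'X_[ca.2].
  have /(chart_homogeneous phi)[b gb] := @sd_homog _ _ _ D i.
  have [|c [m cm]] := mpoly_piece_term gb; last by exists (c, m).
  rewrite -(raddf0 phi) (inj_eq (chart_inj phi)).
  apply/eqP => g0; have Z1 : poly_in (Z i) (1 : S).
    by move=> m; rewrite msupp1 inE => /eqP-> j _; apply: mnm0E.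
  by have /eqP := sd_free Z1 (etrans (scale1r (g i)) g0); rewrite oner_eq0.
have /choice[ca caP] := term.
pose c i := (ca i).1; pose a i := (ca i).2.
have c0 i : c i != 0 by have [] := caP i.
have ga i : phi (g i) = c i *: 'X_[a i] by have [] := caP i.
(* Otherwise the monomial m - a_i of K[Z_i] would kill the generator. *)
have boxP i m : box (a i) (Z i) m -> P m.
  move=> bm; apply: contraT => Pm.
  have : ('X_[(m - a i)%MM] : S) = 0.
    apply: (sd_free (box_poly_in bm)).
    apply: (chart_inj phi); rewrite raddf0; apply/mpolyP => k.
    rewrite (chart_term_scale _ _ (ga i)) mcoeff0 mcoeffX.
    case: ifP => // /andP[Pk ak]; case: eqP => [E|_]; last by rewrite mulr0.
    by move: Pm; rewrite -(submK (box_lem bm)) E (submK ak) Pk.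
  by move/eqP; rewrite -msupp_eq0 msuppX.
exists (sd_size D), a, Z; split.
- move=> m; split=> [Pm|[i]]; last exact: boxP.
  (* Some component of the element x^m has a nonzero coefficient at m. *)
  have [x xm] := chart_onto phi Pm.
  have [y yi xy] := @sd_span _ _ _ D x.
  have : (phi x)@_m != 0 by rewrite xm mcoeffX eqxx oner_eq0.
  rewrite xy !raddf_sum /= => /eqP sum0.
  have [i /eqP] : exists i, (phi (y i))@_m <> 0.
    apply: contrapT => none; apply: sum0; rewrite big1 // => i _.
    by apply: contrapT => yim; apply: none; exists i.
  have [p pZ ->] := yi i; rewrite (chart_term_scale p m (ga i)) Pm /=.
  case: ifP => [am|]; last by rewrite eqxx.
  rewrite mulf_eq0 negb_or => /andP[_ pm].
  by exists i; apply: poly_in_box pZ am pm.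
- move=> m i j bi bj; apply/eqP; apply: contraT => ij.
  (* The element x^m lies in both summands, so their sum is not direct. *)
  pose q k : S := (c k)^-1 *: 'X_[(m - a k)%MM].
  have qZ k : box (a k) (Z k) m -> poly_in (Z k) (q k).
    by move=> bk l /msuppZ_le; apply: box_poly_in.
  have qm k : box (a k) (Z k) m -> phi (q k *: g k) = 'X_[m].
    move=> bk; have am := box_lem bk; apply/mpolyP => l.
    rewrite (chart_term_scale _ _ (ga k)) mcoeffZ !mcoeffX mulrA divff // mul1r.
    have [<-|ml] := eqVneq m l; first by rewrite (boxP k m bk) am eqxx.
    case: ifP => // /andP[_ al]; case: eqP => // E; case/eqP: ml.
    by rewrite -(submK am) E submK.
  pose y k := if k == i then q i *: g i
              else if k == j then - q j *: g j else 0.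
  have yZ k : stanley_space (g k) (Z k) (y k).
    rewrite /y; case: eqP => [->|_]; first by exists (q i); first exact: qZ.
    case: eqP => [->|_]; last by exists 0; rewrite ?scale0r // => l; rewrite msupp0.
    by exists (- q j) => // l; rewrite (perm_mem (msuppN _)); apply: qZ.
  have y0 : \sum_k y k = 0.
    rewrite (bigD1 i) //= (bigD1 j) /=; last by rewrite eq_sym.
    rewrite big1 => [|k /andP[/negPf ki /negPf kj]]; last by rewrite /y ki kj.
    rewrite /y !eqxx eq_sym (negPf ij) addr0 scaleNr.
    by apply/eqP; rewrite subr_eq0 -(inj_eq (chart_inj phi)) !qm.
  have := qm i bi; have := sd_direct yZ y0 i; rewrite /y eqxx => -> /eqP.
  by rewrite raddf0 eq_sym -msupp_eq0 msuppX.
move=> i; rewrite /sdepth_decomp; exact: (@Order.TotalTheory.bigmin_le _ nat).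
Qed.

(** The generators are the monomials at the corners of the boxes; comparing
coefficients at each monomial reduces spanning and directness to the fact that
each monomial of P lies in exactly one box. *)
Lemma box_partition_stanley d :
  (d <= n)%N -> box_partition P d ->
  exists D : stanleyDecomp M, (d <= sdepth_decomp D)%N.
Proof.
move=> dn [t [a [Z [cov disj dZ]]]].
have Pa i : P (a i).
  by apply/cov; exists i; apply/forallP => j; case: ifP.
have /choice[e ea] : forall i, exists x, phi x = 'X_[a i].
  by move=> i; apply: chart_onto.
have coef i p m : (phi (p *: e i))@_m =
    if P m && (a i <= m)%MM then p@_(m - a i)%MM else 0.
  by rewrite (@chart_term_scale 1 (a i)) ?scale1r // mul1r.
have coef0 i p m : poly_in (Z i) p -> ~~ box (a i) (Z i) m ->
    (phi (p *: e i))@_m = 0.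
  move=> pZ bm; rewrite coef; case: ifP => // /andP[_ am].
  by apply/eqP; apply: contraNT bm; apply: poly_in_box.
have e_homog i : homogeneous (e i).
  apply/(chart_homogeneous phi); exists (zdeg (a i)) => m.
  by rewrite ea msuppX inE => /eqP->.
have e_free i (p : S) : poly_in (Z i) p -> p *: e i = 0 -> p = 0.
  move=> pZ pe0; apply/mpolyP => k; rewrite mcoeff0; apply/eqP.
  apply: contraT => pk; have := coef i p (k + a i)%MM.
  rewrite pe0 raddf0 mcoeff0 lem_addl addmK andbT.
  rewrite (_ : P _ = true); first by move=> E; rewrite -E eqxx in pk.
  apply/cov; exists i; apply: box_addm; apply: pZ.
  by rewrite mcoeff_msupp.
have e_span x : exists2 y : 'I_t -> M,
    forall i, stanley_space (e i) (Z i) (y i) & x = \sum_i y i.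
  pose p i := box_part (phi x) (a i) (Z i).
  exists (fun i => p i *: e i) => [i|].
    by exists (p i) => //; apply: box_part_poly_in.
  apply: (chart_inj phi); apply/mpolyP => m; rewrite raddf_sum raddf_sum /=.
  have [Pm|Pm] := boolP (P m); last first.
    by rewrite chart_supp // big1 // => i _; rewrite chart_supp.
  have /cov[i bi] := Pm.
  rewrite (bigD1 i) //= coef Pm (box_lem bi) mcoeff_box_part // big1 ?addr0 //.
  move=> j ji; apply: coef0; first exact: box_part_poly_in.
  by apply: contra ji => bj; rewrite (disj _ _ _ bi bj).
have e_direct (y : 'I_t -> M) : (forall i, stanley_space (e i) (Z i) (y i)) ->
    \sum_i y i = 0 -> forall i, y i = 0.
  move=> yZ y0 i; apply: (chart_inj phi); rewrite raddf0.
  apply/mpolyP => m; rewrite mcoeff0.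
  have ybox j : ~~ box (a j) (Z j) m -> (phi (y j))@_m = 0.
    by move=> bm; have [p pZ ->] := yZ j; apply: coef0.
  have [bi|/ybox//] := boolP (box (a i) (Z i) m).
  have := congr1 (fun z => (phi z)@_m) y0; rewrite raddf0 mcoeff0 => <-.
  rewrite !raddf_sum /= (bigD1 i) //= big1 ?addr0 // => j ji.
  by apply: ybox; apply: contra ji => bj; rewrite (disj _ _ _ bi bj).
exists (StanleyDecomp e_homog e_free e_span e_direct); rewrite /sdepth_decomp /=.
exact: (@Order.POrderTheory.le_bigmin _ nat).
Qed.

End OneChart.

Lemma sdepth_le_colon (M N : gradedModule K n) P Q u :
  monomial_chart M P -> monomial_chart N Q -> (forall m, Q m = P (m + u)%MM) ->
  (sdepth M <= sdepth N)%N.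
Proof.
move=> phi psi QP; apply/bigmax_leqP => d /asboolP[D Dd].
have dn : (d <= n)%N by rewrite -ltnS.
have := stanley_box_partition phi D; rewrite Dd => /(box_partition_shift u).
rewrite -(funext QP) => /(box_partition_stanley psi dn)[E dE].
have En : (sdepth_decomp E < n.+1)%N.
  by rewrite ltnS; apply: (@Order.TotalTheory.bigmin_le_id _ nat).
apply: leq_trans dE _; rewrite /sdepth.
apply: (@leq_bigmax_cond _ _ _ (Ordinal En)).
by apply/asboolP; exists E.
Qed.

End Charts.

(** * The charts of I and S/I *)

Section Instances.
Variables (K : fieldType) (n : nat) (I : monomialIdeal K n).
Local Notation S := {mpoly K[n]}.

Lemma ideal_chart :
  monomial_chart (ideal_module I) (fun m => ('X_[m] : S) \in mideal I).
Proof.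
have onto m : ('X_[m] : S) \in mideal I ->
    exists x : ideal_module I, \val x = 'X_[m] by move=> mI; exists (ideal_elt mI).
have scale (p : S) (x : ideal_module I) m : (val (p *: x))@_m =
    if ('X_[m] : S) \in mideal I then (p * val x)@_m else 0.
  case: ifPn => // mI; apply/memN_msupp_eq0; apply: contra mI.
  exact: mideal_msupp (valP (p *: x)).
by apply: (@MonomialChart _ _ (ideal_module I) _ (\val : {additive _ -> _})
  val_inj onto scale) => x; split.
Qed.

(** The normal form of [f] modulo I: the representative of its class supported
on monomials outside I. *)
Definition standard_part (f : S) : S :=
  \sum_(m <- msupp f | 'X_[m] \notin mideal I) f@_m *: 'X_[m].

Lemma mcoeff_standard_part f m :
  (standard_part f)@_m = if 'X_[m] \notin mideal I then f@_m else 0.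
Proof.
rewrite raddf_sum /=; under eq_bigr => k _ do rewrite mcoeffZ mcoeffX.
have [mf|/memN_msupp_eq0 f0] := boolP (m \in msupp f).
  rewrite big_mkcond (bigD1_seq m) //= eqxx mulr1 big1 ?addr0 // => k km.
  by rewrite (negPf km) mulr0 if_same.
rewrite big1 ?f0 ?if_same // => k _.
by case: eqVneq => [->|_]; rewrite ?f0 ?mul0r ?mulr0.
Qed.

Lemma standard_part_is_zmod_morphism : zmod_morphism standard_part.
Proof.
move=> f g; apply/mpolyP => m; rewrite mcoeffB !mcoeff_standard_part mcoeffB.
by case: ifP; rewrite ?subr0.
Qed.

Lemma standard_part_eq0 f : (standard_part f == 0) = (f \in mideal I).
Proof.
apply/eqP/idP => [f0|fI].
  apply: msupp_mideal => m; apply: contraTT => mI.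
  have := mcoeff_standard_part f m.
  by rewrite mI f0 mcoeff0 mcoeff_msupp => <-; rewrite eqxx.
apply/mpolyP => m; rewrite mcoeff_standard_part mcoeff0; case: ifPn => // mI.
by apply/memN_msupp_eq0; apply: contra mI; apply: mideal_msupp.
Qed.

Definition quotient_coord (x : quotient_module I) : S :=
  standard_part (repr (x : quotmod (mideal_submod I))).

Lemma quotient_coord_pi f :
  quotient_coord (quotmod_pi (mideal_submod I) f) = standard_part f.
Proof.
apply/eqP; rewrite -subr_eq0 -standard_part_is_zmod_morphism standard_part_eq0.
rewrite -[_ \in _](quotmod_pi_eq (mideal_submod I)).
by rewrite /quotmod_pi reprK.
Qed.

Lemma quotient_coord_is_zmod_morphism : zmod_morphism quotient_coord.
Proof.
move=> x y; have [f ->] := quotmod_piP x; have [g ->] := quotmod_piP y.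
rewrite -quotmod_piB !quotient_coord_pi; exact: standard_part_is_zmod_morphism.
Qed.

HB.instance Definition _ := GRing.isZmodMorphism.Build _ _ quotient_coord
  quotient_coord_is_zmod_morphism.

Lemma quotient_chart :
  monomial_chart (quotient_module I) (fun m => ('X_[m] : S) \notin mideal I).
Proof.
pose pi : S -> quotient_module I := quotmod_pi (mideal_submod I).
have coordK x : pi (quotient_coord x) = x.
  have [f ->] := quotmod_piP x; rewrite quotient_coord_pi; apply/eqP.
  rewrite quotmod_pi_eq -[_ \in _]standard_part_eq0.
  rewrite standard_part_is_zmod_morphism subr_eq0; apply/eqP/mpolyP => m.
  by rewrite !mcoeff_standard_part; case: ifP => // ->.
have onto m : ('X_[m] : S) \notin mideal I ->
    exists x, quotient_coord x = 'X_[m].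
  move=> mI; exists (pi 'X_[m]); rewrite quotient_coord_pi.
  apply/mpolyP => k; rewrite mcoeff_standard_part mcoeffX.
  by have [<-|] := eqVneq m k; rewrite ?mI // if_same.
have scale (p : S) x m : (quotient_coord (p *: x))@_m =
    if ('X_[m] : S) \notin mideal I then (p * quotient_coord x)@_m else 0.
  rewrite -{1}[x]coordK -quotmod_piZ quotient_coord_pi.
  exact: mcoeff_standard_part.
have homogE x : homogeneous x <-> exists b, mpoly_piece b (quotient_coord x).
  split=> [[b [f fb ->]]|[b xb]]; exists b; last by exists (quotient_coord x).
  rewrite quotient_coord_pi => m; rewrite mcoeff_msupp mcoeff_standard_part.
  by case: ifP; rewrite ?eqxx // -mcoeff_msupp => _; apply: fb.
exact: (MonomialChart (can_inj coordK) onto scale homogE).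
Qed.

End Instances.

(** * Stanley depth of colon ideals *)

Unset Implicit Arguments.

Theorem proposition2p7 (K : fieldType) (n : nat) (I : monomialIdeal K n)
    (u : 'X_{1..n}) :
  ((exists2 f : {mpoly K[n]}, f \in mideal I & f != 0) ->
    (sdepth (ideal_module I) <= sdepth (ideal_module (colon I u)))%N) /\
  ('X_[u] \notin mideal I ->
    (sdepth (quotient_module I) <= sdepth (quotient_module (colon I u)))%N).
Proof.
have colonE m : ('X_[m] \in mideal (colon I u)) = ('X_[m + u] \in mideal I).
  by rewrite inE mpolyXD.
split=> _.
  exact: sdepth_le_colon (ideal_chart I) (ideal_chart (colon I u)) colonE.
apply: sdepth_le_colon (quotient_chart I) (quotient_chart (colon I u)) _ => m.
by rewrite colonE.
Qed.
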